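(* Let $R$ be a ring, $M$ an $R$-module and $N$ a proper submodule of $M$. Then the following statements are equivalent: (1) $N$ is a gsdf-absorbing submodule of $M$. (2) For every $r\in R$ with $rM\nsubseteq N$, the submodule $(N:_{M}r)$ is a gsdf-absorbing submodule of $M$. (3) For every $x\in M\setminus N$, the ideal $(N:_{R}x)$ is an sdf-absorbing primary ideal of $R$. (4) For every finitely generated submodule $K$ of $M$ with $K\nsubseteq N$, the ideal $(N:_{R}K)$ is an sdf-absorbing primary ideal of $R$.
   Context: All rings are commutative with identity $1\neq 0$ and all modules are unital. Let $R$ be a ring and $M$ an $R$-module. A proper submodule $N$ of $M$ is called a generalized square-difference factor absorbing submodule (gsdf-absorbing submodule) if for all $u,v\in R$ and $x\in M$, the condition $(u^{2}-v^{2})x\in N$ implies that $(u-v)x\in N$ or $(u+v)^{k}x\in N$ for some integer $k\geq 1$. A proper ideal $I$ of $R$ is called sdf-absorbing primary (square-difference factor absorbing primary) if for all $u,v\in R$, $u^{2}-v^{2}\in I$ implies $u-v\in I$ or $(u+v)^{k}\in I$ for some integer $k\geq 1$. For a submodule $N$ of $M$, $r\in R$, $x\in M$ and a submodule $K$ of $M$: $(N:_{M}r)=\{y\in M\mid ry\in N\}$, $(N:_{R}x)=\{a\in R\mid ax\in N\}$, and $(N:_{R}K)=\{a\in R\mid aK\subseteq N\}$. *)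

(* Defs.v *)
From mathcomp Require Import all_boot all_algebra.
From mathcomp Require Import boolp.

Set Implicit Arguments.
Unset Strict Implicit.
Unset Printing Implicit Defensive.

Import GRing.Theory.

Local Open Scope ring_scope.

(* Submodules and ideals are boolean collective predicates, as for
   [GRing.submod_closed] and [idealr_closed]. Since [boolp] makes every
   proposition boolean, these are arbitrary subsets. *)

Definition proper_submodule (R : comNzRingType) (M : lmodType R)
    (N : {pred M}) : Prop :=
  GRing.submod_closed N /\ exists x, x \notin N.

Definition gsdf_absorbing (R : comNzRingType) (M : lmodType R)
    (N : {pred M}) : Prop :=
  proper_submodule N /\
  forall (u v : R) (x : M), (u ^+ 2 - v ^+ 2) *: x \in N ->
    (u - v) *: x \in N \/ exists2 k : nat, (1 <= k)%N & (u + v) ^+ k *: x \in N.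

(* [idealr_closed] includes properness, in the form 1 \notin I. *)
Definition sdf_absorbing_primary (R : comNzRingType) (I : {pred R}) : Prop :=
  idealr_closed I /\
  forall u v : R, u ^+ 2 - v ^+ 2 \in I ->
    u - v \in I \/ exists2 k : nat, (1 <= k)%N & (u + v) ^+ k \in I.

(* (N :_M r) *)
Definition colon_scalar (R : comNzRingType) (M : lmodType R)
    (N : {pred M}) (r : R) : {pred M} :=
  [pred y | r *: y \in N].

(* (N :_R x) *)
Definition colon_elt (R : comNzRingType) (M : lmodType R)
    (N : {pred M}) (x : M) : {pred R} :=
  [pred a | a *: x \in N].

(* (N :_R K) *)
Definition colon_sub (R : comNzRingType) (M : lmodType R)
    (N K : {pred M}) : {pred R} :=
  [pred a | `[< forall y, y \in K -> a *: y \in N >]].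

Definition fg_submodule (R : comNzRingType) (M : lmodType R)
    (K : {pred M}) : Prop :=
  GRing.submod_closed K /\
  exists (n : nat) (g : 'I_n -> M),
    forall x, x \in K <-> exists c : 'I_n -> R, x = \sum_(i < n) c i *: g i.

(* Main.v *)
(* The only step that is not a direct unfolding is (3) => (4). Suppose u - v
   does not send K into N, so some y in K has (u - v) y outside N, and hence
   (u + v)^k y in N for some k. A generator g with (u - v) g in N is handled by
   translating it: (u - v) (g + y) lies outside N, so some power of u + v sends
   g + y, and therefore g, into N. As K is finitely generated, one power of
   u + v sends all of K into N. *)
From HB Require Import structures.
Require Import Defs.
From mathcomp Require Import all_boot all_algebra.
From mathcomp Require Import boolp.

Set Implicit Arguments.
Unset Strict Implicit.
Unset Printing Implicit Defensive.

Import GRing.Theory.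

Local Open Scope ring_scope.

Section Submodules.

Variables (R : comNzRingType) (M : lmodType R) (N : submodClosed M).

(* [submodClosed] does not inherit from [zmodClosed], so [rpredDl] does not
   apply. *)
Lemma submod_memDl x y : x \in N -> (x + y \in N) = (y \in N).
Proof.
move=> xN; apply/idP/idP => [xyN|]; last exact: rpredD.
by rewrite -[y](addKr x) -scaleN1r rpredD // rpredZ.
Qed.

Lemma submod_memXW a m n x :
  (m <= n)%N -> a ^+ m *: x \in N -> a ^+ n *: x \in N.
Proof. by move=> le_mn axN; rewrite -(subnK le_mn) exprD -scalerA rpredZ. Qed.

Lemma colon_scalar_submod r : GRing.submod_closed (colon_scalar N r).
Proof.
split=> [|a x y]; rewrite !inE ?scaler0 ?rpred0 // => rxN ryN.
by rewrite scalerDr scalerA mulrC -scalerA rpredD // rpredZ.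
Qed.

Lemma colon_sub_ideal (K : {pred M}) :
  ~ {subset K <= N} -> idealr_closed (colon_sub N K).
Proof.
move=> nKN; split.
- by apply/asboolP => y _; rewrite scale0r rpred0.
- by apply/asboolP => K1; apply: nKN => y /K1; rewrite scale1r.
move=> a b c /asboolP bKN /asboolP cKN; apply/asboolP => y yK.
by rewrite scalerDl -scalerA rpredD ?cKN // rpredZ ?bKN.
Qed.

Lemma colon_elt_ideal x : x \notin N -> idealr_closed (colon_elt N x).
Proof.
move=> xN; split=> [||a b c]; rewrite !inE ?scale0r ?rpred0 ?scale1r //.
by move=> bxN cxN; rewrite scalerDl -scalerA rpredD // rpredZ.
Qed.

(** Membership in [N] survives raising the exponent, so the largest of the finitely many exponents
    serves every [g i]. *)
Lemma uniform_exponent n (g : 'I_n -> M) (a : R) :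
  (forall i, exists2 k, (1 <= k)%N & a ^+ k *: g i \in N) ->
  exists2 k, (1 <= k)%N & forall i, a ^+ k *: g i \in N.
Proof.
move=> /(_ _)/cid2-/all_sig2[k _ akN].
(* The successor keeps the exponent positive even for an empty family, where the maximum is 0. *)
exists (\max_(i < n) k i).+1 => // i.
by apply: submod_memXW (akN i); rewrite leqW ?leq_bigmax.
Qed.

Lemma sdf_absorbing_colon_sub (K : {pred M}) :
    (forall x, x \notin N -> sdf_absorbing_primary (colon_elt N x)) ->
    fg_submodule K -> ~ {subset K <= N} ->
  sdf_absorbing_primary (colon_sub N K).
Proof.
move=> sdfN [submodK [n [g spanK]]] nKN; split; first exact: colon_sub_ideal.
move=> u v /asboolP uvKN; have [?|] := boolP (u - v \in _); first by left.
rewrite unfold_in /= => /asboolPn/existsNP[y /not_implyP[yK /negP uvyN]]; right.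
(* On an element that [u - v] keeps outside [N], the first alternative of the hypothesis on
   [colon_elt N x] is excluded, so a power of [u + v] must work. *)
have power x : x \in K -> (u - v) *: x \notin N ->
    exists2 k, (1 <= k)%N & (u + v) ^+ k *: x \in N.
  move=> xK uvxN; have xN : x \notin N by apply: contra uvxN; apply: rpredZ.
  have [|uvxN'|//] := (sdfN x xN).2 u v; first by rewrite inE uvKN.
  by rewrite inE (negbTE uvxN) in uvxN'.
have gK i : g i \in K.
  apply/spanK; exists (fun j => (j == i)%:R).
  rewrite (bigD1 i) //= eqxx scale1r big1 ?addr0 // => j /negbTE->.
  by rewrite scale0r.
have [k k_gt0 uvkN] : exists2 k, (1 <= k)%N &
    forall i, (u + v) ^+ k *: g i \in N.
  apply: uniform_exponent => i.
  have [uvgN|] := boolP ((u - v) *: g i \in N); last exact: power.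
  have [l _ uvlyN] := power y yK uvyN.
  have gyK : g i + y \in K by case: submodK => _ linK; rewrite -[g i]scale1r linK.
  have [|m _ uvmN] := power _ gyK; first by rewrite scalerDr submod_memDl.
  exists (maxn l m).+1 => //.
  (* The common exponent sends both [y] and [g i + y] into [N], so the contribution of [y] can be
     cancelled. *)
  rewrite -(@submod_memDl ((u + v) ^+ (maxn l m).+1 *: y)).
    rewrite -scalerDr (addrC y).
    by apply: submod_memXW uvmN; rewrite leqW ?leq_maxr.
  by apply: submod_memXW uvlyN; rewrite leqW ?leq_maxl.
exists k => //; apply/asboolP => x /spanK[c ->].
rewrite scaler_sumr; under eq_bigr do rewrite scalerA mulrC -scalerA.
by apply: rpred_sum => i _; apply: rpredZ.
Qed.

End Submodules.

(** Lets (4) be applied to a single element, which closes the cycle back to (1). *)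
Lemma fg_submodule_cyclic (R : comNzRingType) (M : lmodType R) (x : M) :
  fg_submodule [pred y | `[< exists a : R, y = a *: x >]].
Proof.
split.
  split=> [|a y z /asboolP[b ->] /asboolP[c ->]]; apply/asboolP.
    by exists 0; rewrite scale0r.
  by exists (a * b + c); rewrite scalerDl scalerA.
exists 1%N, (fun=> x) => y; split=> [/asboolP[a ->]|[c ->]].
  by exists (fun=> a); rewrite big_ord1.
by apply/asboolP; exists (c ord0); rewrite big_ord1.
Qed.

Theorem theorem2p5 (R : comNzRingType) (M : lmodType R) (N : {pred M})
    (properN : proper_submodule N) :
  [<-> gsdf_absorbing N;
       forall r : R, ~ (forall y : M, r *: y \in N) ->
         gsdf_absorbing (colon_scalar N r);
       forall x : M, x \notin N -> sdf_absorbing_primary (colon_elt N x);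
       forall K : {pred M}, fg_submodule K -> ~ {subset K <= N} ->
         sdf_absorbing_primary (colon_sub N K)].
Proof.
have [submodN [z zN]] := properN.
pose NS : submodClosed M := HB.pack N (GRing.isSubmodClosed.Build R M N submodN).
tfae.
- move=> [_ gsdfN] r /existsNP[y /negP ryN]; split.
    by split; [exact: (colon_scalar_submod NS) | exists y].
  (* Scalars commute, so the absorbing property of [N] is used at [r *: x]. *)
  move=> u v x; rewrite inE scalerA mulrC -scalerA => /gsdfN.
  rewrite scalerA mulrC -scalerA => -[|[k k_gt0]]; first by left.
  by rewrite scalerA mulrC -scalerA; right; exists k.
- move=> gsdfN x xN; split; first exact: (@colon_elt_ideal _ _ NS).
  (* Taking [r = 1] recovers [N] itself, and [z] shows that this choice is admissible. *)
  have [|_ gsdf1] := gsdfN 1; first by move/(_ z); rewrite scale1r; apply/negP.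
  move=> u v; rewrite inE => uvxN.
  have [||[k k_gt0]] := gsdf1 u v x; rewrite ?inE scale1r //; first by left.
  by right; exists k.
- by move=> sdfN K; apply: (@sdf_absorbing_colon_sub _ _ NS).
move=> sdfN; split=> // u v x uvxN.
have [xN|xN] := boolP (x \in N); first by left; apply: (@rpredZ _ _ NS).
(* For the cyclic submodule generated by [x], a scalar sends [Rx] into [N] exactly when it sends [x]
   into [N]. *)
pose Rx : {pred M} := [pred y | `[< exists a : R, y = a *: x >]].
have xRx : x \in Rx by apply/asboolP; exists 1; rewrite scale1r.
have [|_ sdfRx] := sdfN Rx (fg_submodule_cyclic x).
  by move/(_ x xRx); apply/negP.
have [|/asboolP/(_ x xRx)|[k k_gt0 /asboolP/(_ x xRx)]] := sdfRx u v.
- apply/asboolP => _ /asboolP[a ->].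
  by rewrite scalerA mulrC -scalerA; apply: (@rpredZ _ _ NS).
- by left.
by right; exists k.
Qed.
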